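(* Let $\alpha$ be a sequence over a finite alphabet in which every letter of $\mathcal{A}_\alpha$ appears infinitely often. If $\alpha$ is aperiodic and $\#\mathcal{A}_\alpha=\ell\ge 2$, then $p^*_\alpha(k)\ge 2k+\ell-2$ for all $k\in\mathbb{N}$.
   Context: $\mathbb{N}=\{1,2,\ldots\}$, $\mathbb{N}_0=\{0,1,2,\ldots\}$. A sequence over a finite alphabet $\mathcal{A}$ is $\alpha=\alpha_0\alpha_1\ldots\in\mathcal{A}^{\mathbb{N}_0}$; $\mathcal{A}_\alpha$ is the set of letters that occur in $\alpha$. The shift is $\sigma(\alpha_0\alpha_1\alpha_2\ldots)=\alpha_1\alpha_2\ldots$. A sequence is periodic if $\sigma^t(\alpha)=\alpha$ for some $t\in\mathbb{N}$, eventually periodic if some $\sigma^t(\alpha)$ is periodic, and aperiodic if it is neither periodic nor eventually periodic. A $k$-sized window is a set $\tau=\{0=\tau(0)<\tau(1)<\cdots<\tau(k-1)\}\subset\mathbb{N}_0$. For $n\in\mathbb{N}_0$ put $\alpha[n+\tau]=\alpha_{n+\tau(0)}\alpha_{n+\tau(1)}\ldots\alpha_{n+\tau(k-1)}$ and $F_\alpha(\tau)=\{\alpha[n+\tau]:n\in\mathbb{N}_0\}$. The maximal pattern complexity of $\alpha$ is $p^*_\alpha(k)=\sup_\tau \#F_\alpha(\tau)$, the supremum being over all $k$-sized windows $\tau$. *)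

(* Defs.v *)
From mathcomp Require Import all_boot all_order finmap.
From mathcomp Require Import boolp classical_sets functions cardinality.

Set Implicit Arguments.
Unset Strict Implicit.
Unset Printing Implicit Defensive.

Local Open Scope classical_set_scope.

Definition shift (A : Type) (alpha : nat -> A) : nat -> A :=
  fun n => alpha n.+1.

Definition periodic (A : Type) (alpha : nat -> A) : Prop :=
  exists2 t, 0 < t & iter t (@shift A) alpha = alpha.

Definition eventually_periodic (A : Type) (alpha : nat -> A) : Prop :=
  exists t, periodic (iter t (@shift A) alpha).

Definition aperiodic (A : Type) (alpha : nat -> A) : Prop :=
  ~ periodic alpha /\ ~ eventually_periodic alpha.

Definition letters (A : finType) (alpha : nat -> A) : set A := range alpha.

Definition recurrent_letters (A : finType) (alpha : nat -> A) : Prop :=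
  forall a, letters alpha a -> infinite_set [set n | alpha n = a].

(* A window is its increasing enumeration tau(0) < ... < tau(k-1).  As entries
   are natural numbers, "ohead tau = Some 0" says tau(0) = 0; in particular
   there is no window of size 0. *)
Definition window (k : nat) (tau : k.-tuple nat) : Prop :=
  ohead tau = Some 0 /\ sorted ltn tau.

Definition factor (A : finType) (alpha : nat -> A) (k : nat)
    (tau : k.-tuple nat) (n : nat) : k.-tuple A :=
  [tuple alpha (n + tnth tau i) | i < k].

Definition factors (A : finType) (alpha : nat -> A) (k : nat)
    (tau : k.-tuple nat) : set (k.-tuple A) :=
  range (factor alpha tau).

(* The cardinal of a set over a finite type; fset_set is junk only on infinite
   sets, and there are none here. *)
Definition card_set (T : finType) (X : set T) : nat := #|` fset_set X|%fset.

Definition factor_counts (A : finType) (alpha : nat -> A) (k : nat) : set nat :=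
  [set card_set (factors alpha tau) | tau in @window k].

(* The supremum is taken in nat; it is the genuine least upper bound for
   k > 0, see max_pattern_complexity_sup. *)
Definition max_pattern_complexity (A : finType) (alpha : nat -> A) (k : nat) :
    nat :=
  supremum 0 (factor_counts alpha k).

Lemma max_pattern_complexity_sup (A : finType) (alpha : nat -> A) (k : nat) :
  0 < k ->
  supremums (factor_counts alpha k) (max_pattern_complexity alpha k).
Proof.
case: k => // k _.
have win : window [tuple of iota 0 k.+1].
  by split => //; exact: iota_ltn_sorted.
have ne : factor_counts alpha k.+1 !=set0.
  by exists (card_set (factors alpha [tuple of iota 0 k.+1]));
     exists [tuple of iota 0 k.+1].
have /nat_supremums_neq0 [m mP] : ubound (factor_counts alpha k.+1) !=set0.
  exists #|{: k.+1.-tuple A}| => _ [tau _ <-].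
  rewrite /card_set cardfE leEnat; exact: (leq_card _ val_inj).
rewrite /max_pattern_complexity /supremum; case: ifPn => [/eqP e|_].
  by move: ne; rewrite e => -[].
by case: xgetP => [? ? //|/(_ m)/(_ mP)].
Qed.

(* Main.v *)
(* Every window [tau] has an extension by some [n > max tau] with at least two
   more words; starting from the window {0}, which has [l] words, this gives
   the bound.  Two more words arise as soon as two distinct [tau]-words "split",
   i.e. the letter at distance [n] is not a function of the word.  Let [omega]
   be a limit point of the orbit of [alpha], chosen periodic or else not
   eventually periodic.
   - For every large [n] some [tau]-word of [omega] splits: otherwise [omega]
     would be eventually periodic in the second case; in the first case, the
     end of a long [omega]-stretch of [alpha] provides a split word.
   - If [alpha] has infinitely many occurrences of [tau]-words foreign to
     [omega], one such word occurs twice, and splits for infinitely many [n].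
   - Otherwise let [n] be the distance of two occurrences of a long prefix of
     [omega].  If a word [x] of [omega] does not split, then the letter at
     distance [n] is always its own first letter; if this holds for all [x] but
     one, then [alpha] is eventually [n]-periodic, which is excluded. *)
Require Import Defs.
From mathcomp Require Import all_boot.
From mathcomp Require Import finmap zify.
From mathcomp Require Import boolp classical_sets cardinality.

Set Implicit Arguments.
Unset Strict Implicit.
Unset Printing Implicit Defensive.

(** * Events that happen infinitely often, and the pigeonhole principle *)

Definition infinitely_often (Q : nat -> Prop) : Prop :=
  forall N, exists2 n, N <= n & Q n.

Lemma io_sub (Q Q' : nat -> Prop) :
  (forall n, Q n -> Q' n) -> infinitely_often Q -> infinitely_often Q'.
Proof. by move=> QQ' ioQ N; have [n Nn /QQ'] := ioQ N; exists n. Qed.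

Lemma not_io (Q : nat -> Prop) :
  ~ infinitely_often Q -> exists N, forall n, N <= n -> ~ Q n.
Proof.
move=> nio; apply: contrapT => nex; apply: nio => N.
apply: contrapT => nQ; apply: nex; exists N => n Nn Qn.
by apply: nQ; exists n.
Qed.

Lemma io_fiber (T : finType) (c : nat -> T) (Q : nat -> Prop) :
  infinitely_often Q ->
  exists t, infinitely_often (fun n => Q n /\ c n = t).
Proof.
move=> ioQ; apply: contrapT => nex.
have /choice[B BP] t : exists N, forall n, N <= n -> ~ (Q n /\ c n = t).
  by apply: not_io => iot; apply: nex; exists t.
have [n Bn Qn] := ioQ (\max_t B t).
by apply: (BP (c n) n) => //; apply: leq_trans Bn; exact: leq_bigmax.
Qed.

Definition nonperiodic_tails (A : Type) (alpha : nat -> A) : Prop :=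
  forall q, 0 < q -> infinitely_often (fun m => alpha (m + q) <> alpha m).

Lemma iter_shiftE (A : Type) (alpha : nat -> A) t n :
  iter t (@shift A) alpha n = alpha (n + t).
Proof. by elim: t n => [|t IH] n /=; rewrite ?addn0 // /shift IH addSnnS. Qed.

Lemma aperiodic_tails (A : Type) (alpha : nat -> A) :
  aperiodic alpha -> nonperiodic_tails alpha.
Proof.
move=> [_ nep] q q0; apply: contrapT => /not_io[N HN]; apply: nep.
exists N, q => //; apply/funext => n; rewrite !iter_shiftE.
by rewrite addnAC; apply: contrapT; apply: HN; exact: leq_addl.
Qed.

(** * Limit points of the orbit under the shift *)

Definition limit_point (A : Type) (alpha omega : nat -> A) : Prop :=
  forall S, infinitely_often
    (fun p => forall i, i < S -> alpha (p + i) = omega i).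

(** König's argument: if a word occurs at arbitrarily late places, then by pigeonhole on the next
    letter so does one of its one-letter extensions. *)
Lemma limit_point_exists (A : finType) (alpha : nat -> A) :
  exists omega, limit_point alpha omega.
Proof.
pose good (w : seq A) := infinitely_often
  (fun p => forall i, i < size w -> alpha (p + i) = nth (alpha 0) w i).
have /choice[next nextP] w : exists a, good w -> good (rcons w a).
  have [gw|ngw] := pselect (good w); last by exists (alpha 0).
  have [a ioa] := io_fiber (fun p => alpha (p + size w)) gw.
  exists a => _; apply: io_sub ioa => p [pw pa] i.
  rewrite size_rcons nth_rcons ltnS leq_eqVlt => /orP[/eqP->|iw].
    by rewrite ltnn eqxx.
  by rewrite iw pw.
pose ws := fix ws s := if s is s'.+1 then rcons (ws s') (next (ws s')) else [::].
have size_ws s : size (ws s) = s by elim: s => //= s IH; rewrite size_rcons IH.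
have good_ws s : good (ws s).
  by elim: s => [|s IH] /=; [move=> N; exists N | exact: nextP].
have nth_ws s i : i < s -> nth (alpha 0) (ws s) i = next (ws i).
  elim: s => //= s IH; rewrite nth_rcons size_ws ltnS leq_eqVlt.
  by case/orP => [/eqP->|lis]; rewrite ?ltnn ?eqxx // lis IH.
exists (fun i => next (ws i)) => S.
apply: io_sub (good_ws S) => p; rewrite size_ws => pS i iS.
by rewrite pS // nth_ws.
Qed.

Lemma limit_point_shift (A : Type) (alpha omega : nat -> A) t :
  limit_point alpha omega -> limit_point alpha (fun i => omega (i + t)).
Proof.
move=> lim S N; have [p Np pS] := lim (S + t) N.
exists (p + t); first exact: leq_trans (leq_addr _ _).
by move=> i iS; rewrite -pS ?ltn_add2r // -addnA (addnC t).
Qed.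

Lemma limit_point_dichotomy (A : finType) (alpha : nat -> A) :
  exists2 omega, limit_point alpha omega &
    nonperiodic_tails omega \/
    exists2 q, 0 < q & forall i, omega (i + q) = omega i.
Proof.
have [omega lim] := limit_point_exists alpha.
have [np|] := pselect (nonperiodic_tails omega).
  by exists omega => //; left.
move/existsNP => [q /not_implyP[q0 /not_io[N HN]]].
exists (fun i => omega (i + N)); first exact: limit_point_shift.
right; exists q => // i; rewrite addnAC.
by apply: contrapT; apply: HN; exact: leq_addl.
Qed.

(** * Splitting words by one more position *)

Section Splitting.
Variables (A : finType) (alpha : nat -> A) (k : nat) (tau : k.-tuple nat).

Definition splits (n : nat) (x : k.-tuple A) : Prop :=
  exists m m', [/\ factor alpha tau m = x, factor alpha tau m' = x &
                   alpha (m + n) <> alpha (m' + n)].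

Lemma eq_factor (omega : nat -> A) m p :
  (forall t, t \in tau -> alpha (m + t) = omega (p + t)) ->
  factor alpha tau m = factor omega tau p.
Proof.
by move=> e; apply: eq_from_tnth => i; rewrite !tnth_mktuple e ?mem_tnth.
Qed.

(** Any late [j] at which [alpha] changes under the shift by [m' - m] gives the distance
    [n = j - m]. *)
Lemma twice_splits_io m m' :
  nonperiodic_tails alpha -> m < m' ->
  factor alpha tau m = factor alpha tau m' ->
  infinitely_often (fun n => splits n (factor alpha tau m)).
Proof.
move=> np mm' e N.
have d0 : 0 < m' - m by rewrite subn_gt0.
have [j Nj neq] := np _ d0 (N + m).
exists (j - m); first by lia.
exists m', m; split=> //; have -> : m' + (j - m) = j + (m' - m) by lia.
by have -> : m + (j - m) = j by lia.
Qed.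

Hypothesis np : nonperiodic_tails alpha.
Variable omega : nat -> A.
Hypothesis lim : limit_point alpha omega.

Lemma limit_factor N p : exists2 m, N <= m &
  factor alpha tau m = factor omega tau p.
Proof.
have [P NP HP] := lim (p + (\max_(t <- tau) t).+1) N.
exists (P + p); first exact: leq_trans (leq_addr _ _).
apply: eq_factor => t tt; rewrite -addnA HP // ltn_add2l ltnS.
exact: leq_bigmax_seq.
Qed.

(** If no word of [omega] splits at [n], a table gives the letter at distance [n] from each of its
    words. There are finitely many tables, so if this happened for infinitely many [n], some
    [n < n'] would share one, and [omega] would be eventually periodic with period [n' - n]. *)
Lemma nonperiodic_limit_splits : nonperiodic_tails omega ->
  exists N, forall n, N <= n -> exists p, splits n (factor omega tau p).
Proof.
move=> npo; apply: contrapT => nex.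
have ioQ : infinitely_often
    (fun n => ~ exists p, splits n (factor omega tau p)).
  apply: contrapT => /not_io[N HN]; apply: nex; exists N => n Nn.
  exact: contrapT (HN n Nn).
have /choice[rep repP] x : exists m,
    (exists p, factor omega tau p = x) -> factor alpha tau m = x.
  have [[p <-]|no] := pselect (exists p, factor omega tau p = x); last first.
    by exists 0 => /no.
  by have [m _ mp] := limit_factor 0 p; exists m.
have [c ioc] := io_fiber (fun n => [ffun x => alpha (rep x + n)]) ioQ.
have [n _ [nQ nc]] := ioc 0.
have [n' ltnn' [nQ' nc']] := ioc n.+1.
have omegaE j : (~ exists p, splits j (factor omega tau p)) ->
    forall p, omega (p + j) = alpha (rep (factor omega tau p) + j).
  move=> jQ p; apply: contrapT => neq; apply: jQ; exists p.
  have [P _ HP] := lim (p + (\max_(t <- tau) t).+1 + j.+1) 0.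
  exists (P + p), (rep (factor omega tau p)); split; last 1 first.
  - by rewrite -addnA HP //; lia.
  - apply: eq_factor => t tt; rewrite -addnA HP //.
    have := leq_bigmax_seq (F := id) t tt isT => /=; lia.
  - by apply: repP; exists p.
have d0 : 0 < n' - n by rewrite subn_gt0.
have [m nm] := npo _ d0 n; apply.
have -> : m + (n' - n) = (m - n) + n' by lia.
rewrite -{2}(subnK nm) !omegaE //.
by move: nc'; rewrite -nc => /ffunP/(_ (factor omega tau (m - n))); rewrite !ffunE.
Qed.

(* A long occurrence of a [q]-periodic limit point ends at some [e] with
   [alpha e <> alpha (e + q)], and the windows at [e - n] and [e - n + q] both
   lie inside it. *)
Lemma periodic_limit_splits q : 0 < q -> (forall i, omega (i + q) = omega i) ->
  forall n, (forall t, t \in tau -> t < n) ->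
  exists p, splits n (factor omega tau p).
Proof.
move=> q0 per n taun.
have [P _ HP] := lim (n + q) 0.
have ex_e : exists e, (P <= e) && (alpha (e + q) != alpha e).
  by have [e Pe /eqP ne] := np q0 P; exists e; rewrite Pe.
case: (ex_minnP ex_e) => e /andP[Pe ne] mine.
have perP j : P <= j -> j < e -> alpha (j + q) = alpha j.
  move=> Pj je; apply/eqP; apply: contraTT je => nj.
  by rewrite -leqNgt mine // Pj.
(* If [e < P + n], both [e] and [e + q] lie in the copied prefix of length [n + q], where [alpha]
   follows the periodic [omega]. *)
have Pne : P + n <= e.
  rewrite leqNgt; apply/negP => lte; case/eqP: ne.
  have -> : e + q = P + (e - P + q) by lia.
  rewrite HP; last by lia.
  by rewrite per -[in RHS](subnKC Pe) HP //; lia.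
have alphaE i : P + i < e -> alpha (P + i) = omega i.
  elim/ltn_ind: i => i IH ie; have [lti|lei] := ltnP i (n + q); first exact: HP.
  have qi : q <= i by lia.
  rewrite -(subnK qi) per addnA perP; [|by lia|by lia].
  by apply: IH; lia.
exists (e - n - P), (e - n), (e - n + q); split.
- apply: eq_factor => t /taun tn.
  by rewrite -alphaE; [congr alpha|]; lia.
- apply: eq_factor => t /taun tn.
  have -> : e - n + q + t = (e - n + t) + q by lia.
  by rewrite perP; [rewrite -alphaE; [congr alpha|]|..]; lia.
- apply/eqP; rewrite eq_sym.
  have -> : e - n + q + n = e + q by lia.
  by have -> : e - n + n = e by lia.
Qed.

Lemma return_splits M N : 0 \in tau ->
  (forall m, M <= m -> exists p, factor alpha tau m = factor omega tau p) ->
  exists2 n, N <= n & exists x y, [/\ x <> y, splits n x & splits n y].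
Proof.
move=> tau0 inomega.
(* Fixing one position for each word of [omega] lets a single prefix, of length [S], contain them
   all. *)
have /choice[pos posP] (x : k.-tuple A) : exists p,
    (exists p', factor omega tau p' = x) -> factor omega tau p = x.
  have [[p <-]|no] := pselect (exists p, factor omega tau p = x).
    by exists p.
  by exists 0 => /no.
pose S := (\max_x pos x + (\max_(t <- tau) t)).+1.
have [P _ HP] := lim S 0.
have [P' PP' HP'] := lim S (P + N).+1.
pose n := P' - P.
exists n; first by rewrite /n; lia.
(* The prefix of length [S] occurs at [P] and at [P + n], so each word of [omega] occurs in [alpha]
   at a place where the shift by [n] keeps the letter. *)
have ret p : exists2 m, factor alpha tau m = factor omega tau p &
    alpha (m + n) = alpha m.
  set x := factor omega tau p.
  have px : factor omega tau (pos x) = x by apply: posP; exists p.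
  have lex : pos x <= \max_x pos x by exact: leq_bigmax.
  exists (P + pos x).
    rewrite -[RHS]px; apply: eq_factor => t tt; rewrite -addnA HP //.
    have := leq_bigmax_seq (F := id) t tt isT => /=; rewrite /S; lia.
  have -> : P + pos x + n = P' + pos x by rewrite /n; lia.
  by rewrite HP ?HP' // /S; lia.
apply: contrapT => nsplit.
have {nsplit}uniq x y : splits n x -> splits n y -> x = y.
  by move=> sx sy; apply: contrapT => xy; apply: nsplit; exists x, y.
have alpha_tau m m' : factor alpha tau m = factor alpha tau m' ->
    alpha m = alpha m'.
  have /tnthP[i i0] := tau0.
  by move/(congr1 (fun w => tnth w i)); rewrite !tnth_mktuple -i0 !addn0.
have moves m : M <= m -> alpha (m + n) <> alpha m ->
    splits n (factor alpha tau m).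
  move=> Mm neq; have [p mp] := inomega m Mm; have [m' m'p m'n] := ret p.
  exists m, m'; split=> //; first by rewrite m'p mp.
  by rewrite m'n (alpha_tau m' m) // m'p mp.
have n0 : 0 < n by rewrite /n; lia.
have [m0 Mm0 neq0] := np n0 M.
have [m m0m neq] := np n0 m0.
(* A place [m] where [alpha] changes under the shift by [n] carries the unique
   split word, hence the letter [z := alpha m0]; so a residue class mod [n]
   which leaves [z] can never change again. *)
have movesz j : M <= j -> alpha (j + n) <> alpha j -> alpha j = alpha m0.
  move=> Mj nj; apply: alpha_tau; apply: uniq; exact: moves.
have const j i : M <= j -> alpha j <> alpha m0 -> alpha (j + i * n) = alpha j.
  move=> Mj jz; elim: i => [|i IH]; first by rewrite addn0.
  rewrite mulSn addnCA addnC -[RHS]IH; apply: contrapT => /movesz.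
  by rewrite IH => /(_ (leq_trans Mj (leq_addr _ _))).
have stays r : exists B, forall i, B <= i -> M <= r + i * n ->
    alpha (r + i * n + n) = alpha (r + i * n).
  have [[i Mi iz]|no] := pselect (exists2 i, M <= r + i * n &
      alpha (r + i * n) <> alpha m0).
    exists i => j ij _; apply: contrapT => /movesz.
    have -> : r + j * n = r + i * n + (j - i) * n by nia.
    rewrite const // => e; apply: iz; apply: e.
    exact: leq_trans (leq_addr _ _).
  have z i : M <= r + i * n -> alpha (r + i * n) = alpha m0.
    by move=> Mi; apply: contrapT => nz; apply: no; exists i.
  exists 0 => i _ Mi; have := z i.+1; rewrite mulSn addnCA addnC => -> //.
    by rewrite z.
  exact: leq_trans (leq_addr _ _).
have /choice[B BP] := stays.
(* Beyond the largest [B r] no residue class changes any more, which makes [alpha] eventually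
   [n]-periodic. *)
have [j jM] := np n0 (M + (\max_(r < n) B r) * n + n); apply.
have jrn : j %% n < n by rewrite ltn_mod.
have e : j %% n + j %/ n * n = j by rewrite addnC -divn_eq.
have lB : B (j %% n) <= \max_(r < n) B r.
  exact: (leq_bigmax (F := fun r : 'I_n => B r) (Ordinal jrn)).
have Bj : B (j %% n) <= j %/ n.
  by apply: leq_trans lB _; rewrite leq_divRL //; lia.
by have := BP (j %% n) (j %/ n) Bj; rewrite e; apply; lia.
Qed.

End Splitting.

Lemma two_splits (A : finType) (alpha : nat -> A) k (tau : k.-tuple nat) N :
  nonperiodic_tails alpha -> 0 \in tau ->
  exists2 n, N <= n &
    exists x y, [/\ x <> y, splits alpha tau n x & splits alpha tau n y].
Proof.
move=> np tau0.
have [omega lim omegaP] := limit_point_dichotomy alpha.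
have [N' splitN'] : exists N', forall n, N' <= n ->
    exists p, splits alpha tau n (factor omega tau p).
  case: omegaP => [npo|[q q0 per]]; first exact: nonperiodic_limit_splits.
  exists (\max_(t <- tau) t).+1 => n nt.
  apply: (periodic_limit_splits np lim q0 per) => t tt.
  by apply: leq_trans nt; rewrite ltnS; apply: (leq_bigmax_seq (F := id)).
pose out m := ~ exists p, factor alpha tau m = factor omega tau p.
have [ioout|/not_io[M HM]] := pselect (infinitely_often out); last first.
  apply: (return_splits np lim N tau0 (M := M)) => m Mm.
  exact: contrapT (HM m Mm).
have [x iox] := io_fiber (factor alpha tau) ioout.
have [m _ [mout mx]] := iox 0.
have [m' mm' [_ m'x]] := iox m.+1.
have mm'x : factor alpha tau m = factor alpha tau m' by rewrite mx m'x.
(* Beyond [N'] some word of [omega] splits as well; it differs from the recurring word, which is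
   foreign to [omega]. *)
have [n Nn sn] := twice_splits_io np mm' mm'x (N + N').
exists n; first by lia.
have [p sp] : exists p, splits alpha tau n (factor omega tau p).
  by apply: splitN'; lia.
exists (factor alpha tau m), (factor omega tau p); split=> //.
by move=> e; apply: mout; exists p.
Qed.

(** * Counting *)

Lemma card_setE (T : finType) (X : set T) :
  card_set X = #|[set x : T | `[< X x >]]|.
Proof.
rewrite /card_set cardE; apply: perm_size; apply: uniq_perm => [||x].
- exact: fset_uniq.
- exact: enum_uniq.
by rewrite mem_enum inE in_fset_set ?in_setE //; exact: finite_finset.
Qed.

Lemma val_factor (A : finType) (alpha : nat -> A) k (tau : k.-tuple nat) m :
  factor alpha tau m = [seq alpha (m + t) | t <- tau] :> seq A.
Proof. by rewrite -[in RHS](map_tnth_enum tau) -map_comp. Qed.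

Lemma factor_rcons (A : finType) (alpha : nat -> A) k (tau : k.-tuple nat) n m :
  factor alpha [tuple of rcons tau n] m =
  [tuple of rcons (factor alpha tau m) (alpha (m + n))].
Proof.
apply: val_inj; rewrite [LHS]val_factor map_rcons.
by congr rcons; rewrite val_factor.
Qed.

(** Extending each old word by the letter seen at one chosen occurrence gives an injective copy [L]
    of the old words; [x] and [y] each have a further extension outside [L]. *)
Lemma card_factors_rcons (A : finType) (alpha : nat -> A) k
    (tau : k.-tuple nat) n x y :
  x <> y -> splits alpha tau n x -> splits alpha tau n y ->
  (card_set (factors alpha tau)).+2 <=
  card_set (factors alpha [tuple of rcons tau n]).
Proof.
move=> xy sx sy; rewrite !card_setE.
set F := [set _ | _]; set F' := [set _ | _].
pose lift (z : k.-tuple A) b := [tuple of rcons z b].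
have lift_inj z z' b b' : lift z b = lift z' b' -> z = z' /\ b = b'.
  by move=> /(congr1 val)/rcons_inj[/val_inj -> ->].
have liftF' m : lift (factor alpha tau m) (alpha (m + n)) \in F'.
  by rewrite inE; apply/asboolP; exists m; rewrite ?factor_rcons.
have /choice[rep repP] z : exists m, z \in F -> factor alpha tau m = z.
  case: (boolP (z \in F)) => [|_]; last by exists 0.
  by rewrite inE => /asboolP[m _ mz]; exists m.
have other z : splits alpha tau n z -> exists2 b,
    b <> alpha (rep z + n) & lift z b \in F'.
  move=> [m [m' [mz m'z neq]]].
  have [e|ne] := eqVneq (alpha (m + n)) (alpha (rep z + n)).
    by exists (alpha (m' + n)); [rewrite -e => /esym | rewrite -m'z].
  by exists (alpha (m + n)); [exact/eqP | rewrite -mz].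
have [b bx bF'] := other x sx; have [c cy cF'] := other y sy.
pose L := [set lift z (alpha (rep z + n)) | z in F].
have notL z d : d <> alpha (rep z + n) -> lift z d \notin L.
  by move=> nd; apply/imsetP => -[z' _ /lift_inj[zz' dz']]; rewrite zz' in nd.
have <- : #|lift x b |: (lift y c |: L)| = #|F|.+2.
  rewrite !cardsU1 !inE !negb_or !notL // card_imset; last first.
    by move=> z z' /lift_inj[].
  by rewrite andbT; case: eqP => // /lift_inj[].
apply: subset_leq_card; rewrite !finset.subUset !finset.sub1set bF' cF' /=.
by apply/fintype.subsetP => _ /imsetP[z zF ->]; rewrite -[z in lift z _](repP z zF).
Qed.

Lemma window_exists (A : finType) (alpha : nat -> A) k :
  nonperiodic_tails alpha ->
  exists2 tau : k.+1.-tuple nat, window tau &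
    2 * k + card_set (letters alpha) <= card_set (factors alpha tau).
Proof.
move=> np; elim: k => [|k [tau [tau0 stau] le_tau]].
  exists [tuple 0] => //; rewrite muln0 !card_setE.
  have inj : injective (fun a : A => [tuple a]) by move=> a b [].
  rewrite -(card_imset _ inj); apply: subset_leq_card; apply/fintype.subsetP.
  move=> x /imsetP[a]; rewrite inE => /asboolP[m _ ma] ->.
  rewrite inE; apply/asboolP; exists m => //.
  by apply: eq_from_tnth => i; rewrite tnth_mktuple !ord1 addn0.
have mem0 : 0 \in tau.
  rewrite -[0 \in tau]/(0 \in tval tau).
  by case: (tval tau) tau0 => //= t s [->]; rewrite mem_head.
(* Taking [n] above every entry of [tau] keeps the extended window increasing. *)
have [n nmax [x [y [xy sx sy]]]] := two_splits (\max_(t <- tau) t).+1 np mem0.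
exists [tuple of rcons tau n].
  split=> /=; first by case: (tval tau) tau0.
  case: (tval tau) stau nmax => // t s; rewrite /= rcons_path => -> /=.
  apply: leq_ltn_trans; apply: (leq_bigmax_seq (F := id)) => //.
  exact: mem_last.
apply: leq_trans (card_factors_rcons xy sx sy).
by lia.
Qed.

Theorem theorem2p11 (A : finType) (alpha : nat -> A) (l : nat)
    (hrec : recurrent_letters alpha)
    (haper : aperiodic alpha)
    (hcard : card_set (letters alpha) = l)
    (hl : 2 <= l)
    (k : nat) (hk : 1 <= k) :
  2 * k + l - 2 <= max_pattern_complexity alpha k.
Proof.
case: k hk => // k hk.
have [tau wtau le_tau] := window_exists k (aperiodic_tails haper).
have [ub _] := max_pattern_complexity_sup alpha hk.
have le_sup : card_set (factors alpha tau) <= max_pattern_complexity alpha k.+1.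
  by apply: ub; exists tau.
by apply: leq_trans le_sup; apply: leq_trans le_tau; rewrite hcard; lia.
Qed.
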